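(* Let $\mathscr{C}_U$ be the set of all pairs $(W,\mu)$ with $\mu\in\mathbb{R}$ and $W=W^T=\begin{bmatrix} W_1 & W_2\\ W_2^T & W_3\end{bmatrix}\in\mathbb{S}^{m+n}$, where $W_1\in\mathbb{S}^n$ is positive definite, $W_2\in\mathbb{R}^{n\times m}$ and $W_3\in\mathbb{S}^m$, such that $W\succeq 0$, $\Theta_{1i}(W,\mu)\preceq 0$ for all $i=1,2,\dots,N$, and $\mu>0$. Then the following statements hold: (a) Any $(W,\mu)\in\mathscr{C}_U$ generates a gain $K=W_2^TW_1^{-1}$ that is stabilizing under the convex-bounded parametric uncertainties (that is, $A-B_2K$ is asymptotically stable for every feasible model $(A,B_2)$) and guarantees $\|H_i(s)\|_\infty\le\gamma$ for all $i=1,2,\dots,N$, with $\gamma=1/\sqrt{\mu}>0$. (b) At optimality, $(W^*,\mu^* )=\operatorname{argmax}\{\mu:(W,\mu)\in\mathscr{C}_U\}$ gives the optimal solution to the $\mathcal{H}_\infty$ guaranteed cost control problem, with $K^*={W_2^*}^{T}{W_1^*}^{-1}$ and $\gamma^*=1/\sqrt{\mu^*}$; that is, $\gamma^*$ is the minimum of the upper bounds $\gamma=1/\sqrt{\mu}$ on the $\mathcal{H}_\infty$-norm given by the elements $(W,\mu)\in\mathscr{C}_U$, and $K^*$ is a stabilizing gain achieving this bound.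
   Context: $\mathbb{S}^k$ denotes the real symmetric $k\times k$ matrices; $M\succeq 0$ ($M\succ 0$) means $M$ is positive semi-definite (positive definite), and $M\preceq 0$ means $-M\succeq 0$. System: $\dot x=Ax+B_2u+B_1w$, $z=Cx+Du$, $u=-Kx$, with $x\in\mathbb{R}^n$, $u\in\mathbb{R}^m$, $w\in\mathbb{R}^l$, $z\in\mathbb{R}^q$, and static state-feedback gain $K\in\mathbb{R}^{m\times n}$. The matrices $B_1,C,D$ are known, and $(A,B_2)$ is uncertain. Uncertainty (structural and convex-bounded): put $p=m+n$ and $F=\begin{bmatrix}A&-B_2\\0&0\end{bmatrix}\in\mathbb{R}^{p\times p}$. The feasible models are those with $F=\sum_{i=1}^N\xi_iF_i$, $\xi_i\ge 0$, $\sum_{i=1}^N\xi_i=1$, where $F_i=\begin{bmatrix}A_i&-B_{2i}\\0&0\end{bmatrix}\in\mathbb{R}^{p\times p}$, $i=1,\dots,N$, are given extreme matrices. The $i$th extreme system is the one with $(A,B_2)=(A_i,B_{2i})$. Standing assumptions (for every feasible model): $[A,B_2]$ is stabilizable with disturbance attenuation $\gamma$ (i.e. there is a gain making $A-B_2K$ asymptotically stable with closed-loop $\mathcal{H}_\infty$-norm at most $\gamma$, for some $\gamma>0$), $[A,C]$ is observable, $C^TD=0$, and $D^TD\succ0$. For a gain $K$, the closed-loop transfer function from $w$ to $z$ of the $i$th extreme system is $H_i(s)=(C-DK)(sI_n-(A_i-B_{2i}K))^{-1}B_1$, and $\|H_i(s)\|_\infty=\sup_\omega\sigma_{\mathrm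 M}[H_i(j\omega)]$, where $\sigma_{\mathrm M}$ is the maximum singular value. Let $Q=\begin{bmatrix}B_1B_1^T&0\\0&0\end{bmatrix}\in\mathbb{S}^p$ and $R=\begin{bmatrix}C^TC&0\\0&D^TD\end{bmatrix}\in\mathbb{S}^p$. Define $\Theta_i(W,\mu)=F_iW+WF_i^T+WRW+\mu Q$, and let $\Theta_{1i}(W,\mu)\in\mathbb{S}^n$ be its upper-left $n\times n$ block. Explicitly, $$\Theta_{1i}(W,\mu)=A_iW_1-B_{2i}W_2^T+W_1A_i^T-W_2B_{2i}^T+W_1C^TCW_1+W_2D^TDW_2^T+\mu B_1B_1^T.$$ The $\mathcal{H}_\infty$ guaranteed cost control problem is the minimization, over stabilizing state-feedback gains, of the upper bound to the $\mathcal{H}_\infty$-norm under all feasible models; here the upper bound in question is $\gamma=1/\sqrt{\mu}$, associated with a pair $(W,\mu)\in\mathscr{C}_U$ and its gain $K=W_2^TW_1^{-1}$. *)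

(* Defs.v *)
From HB Require Import structures.
From mathcomp Require Import all_boot all_order all_algebra.
From mathcomp Require Import complex.
From mathcomp Require Import boolp classical_sets reals ereal.

Set Implicit Arguments.
Unset Strict Implicit.
Unset Printing Implicit Defensive.

Import Order.TTheory GRing.Theory Num.Theory.
Local Open Scope ring_scope.
Local Open Scope complex_scope.
Local Open Scope classical_set_scope.

Definition psdmx (R : realType) k (M : 'M[R]_k) : Prop :=
  M^T = M /\ forall x : 'cV[R]_k, 0 <= (x^T *m M *m x) 0 0.

Definition pdmx (R : realType) k (M : 'M[R]_k) : Prop :=
  M^T = M /\ forall x : 'cV[R]_k, x != 0 -> 0 < (x^T *m M *m x) 0 0.

Definition nsdmx (R : realType) k (M : 'M[R]_k) : Prop := psdmx (- M).

Definition complexmx (R : realType) a b (M : 'M[R]_(a, b)) : 'M[R[i]]_(a, b) :=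
  map_mx (real_complex R) M.

(* Asymptotic stability of x' = M x: the spectrum lies in the open left
   half-plane. *)
Definition asymp_stable (R : realType) n (M : 'M[R]_n) : Prop :=
  forall s : R[i], eigenvalue (complexmx M) s -> Re s < 0.

Definition observable (R : realType) n q (A : 'M[R]_n) (C : 'M[R]_(q, n)) :
    Prop :=
  \rank (\mxcol_(k < n) (C *m A ^+ k)) = n.

(* The eigenvalues of M^* M are real and nonnegative, and finite in number, so
   this supremum is a maximum (it is 0 when M has no column). *)
Definition sigma_max (R : realType) a b (M : 'M[R[i]]_(a, b)) : R :=
  sup [set Num.sqrt lambda | lambda in
        [set lambda : R |
          eigenvalue (map_mx (@conjc R) M^T *m M) lambda%:C]].

Section ClosedLoop.
Context (R : realType) (n m l q : nat).
Context (A : 'M[R]_n) (B2 : 'M[R]_(n, m)) (B1 : 'M[R]_(n, l)).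
Context (C : 'M[R]_(q, n)) (D : 'M[R]_(q, m)).

(* Only meaningful at those s that are not eigenvalues of A - B2 K: invmx is the
   identity function on singular matrices. *)
Definition transfer (K : 'M[R]_(m, n)) (s : R[i]) : 'M[R[i]]_(q, l) :=
  complexmx (C - D *m K) *m invmx (s%:M - complexmx (A - B2 *m K))
    *m complexmx B1.

(* Valued in the extended reals, so that an unbounded frequency response has
   norm +oo. *)
Definition hinf_norm (K : 'M[R]_(m, n)) : \bar R :=
  ereal_sup [set (sigma_max (transfer K (0 +i* omega)))%:E |
              omega in [set: R]].

Definition stabilizable_attenuation (gamma : R) : Prop :=
  exists K, asymp_stable (A - B2 *m K) /\ (hinf_norm K <= gamma%:E)%E.

End ClosedLoop.

Section Uncertainty.
Context (R : realType) (n m l q N : nat).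
Context (As : 'I_N -> 'M[R]_n) (B2s : 'I_N -> 'M[R]_(n, m)).
Context (B1 : 'M[R]_(n, l)) (C : 'M[R]_(q, n)) (D : 'M[R]_(q, m)).

Definition extmx (A : 'M[R]_n) (B2 : 'M[R]_(n, m)) : 'M[R]_(n + m) :=
  block_mx A (- B2) 0 0.

Definition feasible_model (A : 'M[R]_n) (B2 : 'M[R]_(n, m)) : Prop :=
  exists xi : 'I_N -> R,
    [/\ forall i, 0 <= xi i, \sum_i xi i = 1
      & extmx A B2 = \sum_i xi i *: extmx (As i) (B2s i)].

Definition Qmx : 'M[R]_(n + m) := block_mx (B1 *m B1^T) 0 0 0.

Definition Rmx : 'M[R]_(n + m) := block_mx (C^T *m C) 0 0 (D^T *m D).

Definition Theta (i : 'I_N) (W : 'M[R]_(n + m)) (mu : R) : 'M[R]_(n + m) :=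
  let F := extmx (As i) (B2s i) in
  F *m W + W *m F^T + W *m Rmx *m W + mu *: Qmx.

Definition Theta1 (i : 'I_N) (W : 'M[R]_(n + m)) (mu : R) : 'M[R]_n :=
  ulsubmx (Theta i W mu).

Definition CU : set ('M[R]_(n + m) * R) :=
  [set Wmu | [/\ pdmx (ulsubmx Wmu.1), psdmx Wmu.1,
                 forall i, nsdmx (Theta1 i Wmu.1 Wmu.2) & 0 < Wmu.2]].

Definition gain (W : 'M[R]_(n + m)) : 'M[R]_(m, n) :=
  (ursubmx W)^T *m invmx (ulsubmx W).

Definition cost_bound (mu : R) : R := (Num.sqrt mu)^-1.

Definition robustly_stabilizing (K : 'M[R]_(m, n)) : Prop :=
  forall A B2, feasible_model A B2 -> asymp_stable (A - B2 *m K).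

Definition robust_hinf_bound (K : 'M[R]_(m, n)) (gamma : R) : Prop :=
  forall A B2, feasible_model A B2 ->
    (hinf_norm A B2 B1 C D K <= gamma%:E)%E.

(* Candidates of the guaranteed cost problem: a stabilizing gain K with an upper
   bound gamma of the closed-loop norms over all feasible models, where
   (K, gamma) is associated with some element of CU. *)
Definition guaranteed_cost (K : 'M[R]_(m, n)) (gamma : R) : Prop :=
  [/\ robustly_stabilizing K, robust_hinf_bound K gamma
    & exists W mu, [/\ CU (W, mu), K = gain W & gamma = cost_bound mu]].

Definition guaranteed_cost_optimal (K : 'M[R]_(m, n)) (gamma : R) : Prop :=
  guaranteed_cost K gamma /\
  forall K' gamma', guaranteed_cost K' gamma' -> gamma <= gamma'.

Definition CU_argmax (W : 'M[R]_(n + m)) (mu : R) : Prop :=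
  CU (W, mu) /\ forall W' mu', CU (W', mu') -> mu' <= mu.

End Uncertainty.

(* Main.v *)
Require Import Defs.
From HB Require Import structures.
From mathcomp Require Import all_boot all_order all_algebra.
From mathcomp Require Import complex.
From mathcomp Require Import boolp classical_sets reals ereal.
From mathcomp Require Import ring.

Set Implicit Arguments.
Unset Strict Implicit.
Unset Printing Implicit Defensive.

Import Order.TTheory GRing.Theory Num.Theory.
Local Open Scope ring_scope.

(** Fix an element (W, mu) of CU, write P for the block W1 and K for its gain,
    so that W2 = P K^T.  Put a model (A, B2) in closed loop: A' = A - B2 K and
    C' = C - D K.  Since C^T D = 0, the matrix Theta1 of the model is the Riccati
    expression
      A' P + P A'^T + P C'^T C' P + mu B1 B1^T,
    in which the model enters affinely.  Hence its negative semi-definiteness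
    passes from the extreme models to all feasible ones, with the same P and the
    same gain (lemmas Theta1_riccati, riccati_convex and CU_riccati).

    Everything else follows from one computation, a completion of squares.  Let
    x = P y solve A' x + B1 w = s x over the complex numbers, that is, let x be
    the response to an exponential disturbance w exp(s t).  Evaluating the
    Hermitian form of the Riccati expression at y gives
      2 Re(s) y^* P y + |C' x|^2 <= |w|^2 / mu
    (lemmas dissipation_identity and dissipation).  It is used twice.

    With w = 0, s is an eigenvalue of A' and x an eigenvector.  Observability of
    (A, C), C^T D = 0 and D^T D > 0 forbid C' x = 0, as then K x = 0 and C x = 0,
    so that x would be an unobservable mode of A.  Thus |C' x|^2 > 0, and
    Re(s) < 0 because P is positive definite: A' is stable.

    With s = i omega, the first term vanishes and C' x = H(i omega) w, so that
    |H(i omega) w|^2 <= |w|^2 / mu for all w.  Eigenvalues of H^* H are therefore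
    at most 1 / mu, and singular values at most 1 / sqrt mu.

    The optimality claim is then the fact that 1 / sqrt mu decreases in mu. *)

(** * Entries of matrices *)

Section Entries.
Variables (V : pzRingType) (a b : nat).
Implicit Types M L : 'M[V]_(a, b).

Lemma addmx_entry M L i j : (M + L) i j = M i j + L i j.
Proof. exact: mxE. Qed.

Lemma oppmx_entry M i j : (- M) i j = - M i j.
Proof. exact: mxE. Qed.

Lemma scalemx_entry z M i j : (z *: M) i j = z * M i j.
Proof. exact: mxE. Qed.

Lemma map_mx_entry U (f : V -> U) M i j : map_mx f M i j = f (M i j).
Proof. exact: mxE. Qed.
End Entries.

Lemma zeromx_entry (V : nmodType) a b i j : (0 : 'M[V]_(a, b)) i j = 0.
Proof. exact: mxE. Qed.

(** Unlike mxE, these equations leave matrix products folded. *)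
Definition entryE :=
  (zeromx_entry, addmx_entry, oppmx_entry, scalemx_entry, map_mx_entry).

Lemma trmx_mul_eq0 (V : comPzRingType) a b c (M : 'M[V]_(a, b))
    (L : 'M[V]_(a, c)) :
  M^T *m L = 0 -> L^T *m M = 0.
Proof.
by move=> ML0; rewrite -[LHS]trmxK trmx_mul trmxK ML0 trmx0.
Qed.

(** * Hermitian forms and eigenvalues *)

Section HermitianForms.
Variable R : realType.
Local Open Scope complex_scope.

Definition adjmx a b (M : 'M[R[i]]_(a, b)) : 'M[R[i]]_(b, a) :=
  map_mx (@conjc R) M^T.

Lemma adjmxM a b c (M : 'M[R[i]]_(a, b)) (L : 'M_(b, c)) :
  adjmx (M *m L) = adjmx L *m adjmx M.
Proof. by rewrite /adjmx trmx_mul map_mxM. Qed.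

Lemma adjmxB a b (M L : 'M[R[i]]_(a, b)) : adjmx (M - L) = adjmx M - adjmx L.
Proof. by rewrite /adjmx linearB /= map_mxB. Qed.

Lemma adjmxZ a b z (M : 'M[R[i]]_(a, b)) : adjmx (z *: M) = conjc z *: adjmx M.
Proof. by rewrite /adjmx linearZ /= map_mxZ. Qed.

Lemma adjmxK a b (M : 'M[R[i]]_(a, b)) : adjmx (adjmx M) = M.
Proof. by apply/matrixP => i j; rewrite !mxE conjcK. Qed.

Lemma adjmx_complexmx a b (M : 'M[R]_(a, b)) :
  adjmx (complexmx M) = complexmx M^T.
Proof. by apply/matrixP => i j; rewrite !mxE conjc_real. Qed.

Lemma complexmx_Re_Im a b (y : 'M[R[i]]_(a, b)) :
  y = complexmx (map_mx (@complex.Re R) y)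
      + 'i *: complexmx (map_mx (@complex.Im R) y).
Proof. by apply/matrixP => i j; rewrite !mxE -complexE. Qed.

(** For a real symmetric M the cross terms u^T M v and v^T M u cancel.  This
    carries semi-definiteness, stated on real vectors, over to the complex
    eigenvectors and frequency responses. *)
Lemma hermitian_form_Re_Im k (M : 'M[R]_k) (y : 'cV[R[i]]_k) : M^T = M ->
  let u := map_mx (@complex.Re R) y in let v := map_mx (@complex.Im R) y in
  (adjmx y *m complexmx M *m y) 0 0
    = ((u^T *m M *m u) 0 0 + (v^T *m M *m v) 0 0)%:C.
Proof.
move=> Msym u v.
have uMv : (u^T *m M *m v) 0 0 = (v^T *m M *m u) 0 0.
  transitivity ((u^T *m M *m v)^T 0 0); first by rewrite [RHS]mxE.
  by rewrite !trmx_mul trmxK Msym mulmxA.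
have -> : adjmx y = complexmx u^T - 'i *: complexmx v^T.
  apply/matrixP => i j; rewrite !mxE [y j i]complexE /=.
  by simpc.
rewrite [in LHS](complexmx_Re_Im y) -/u -/v.
rewrite mulmxBl mulmxDr !mulmxBl -!scalemxAr -!scalemxAl -!map_mxM scalerA.
rewrite /complexmx !entryE uMv rmorphD /= -expr2 sqr_i.
ring.
Qed.

Lemma psdmx_hermitian_ge0 k (M : 'M[R]_k) (y : 'cV[R[i]]_k) :
  psdmx M -> 0 <= (adjmx y *m complexmx M *m y) 0 0.
Proof.
by case=> Msym M0; rewrite hermitian_form_Re_Im // ler0c addr_ge0.
Qed.

Lemma pdmx_hermitian_gt0 k (M : 'M[R]_k) (y : 'cV[R[i]]_k) :
  pdmx M -> y != 0 -> 0 < (adjmx y *m complexmx M *m y) 0 0.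
Proof.
case=> Msym M0 y0; rewrite hermitian_form_Re_Im // ltcR.
have ge0 (x : 'cV[R]_k) : 0 <= (x^T *m M *m x) 0 0.
  by have [->|/M0/ltW//] := eqVneq x 0; rewrite mulmx0 mxE.
have [u0|u0] := eqVneq (map_mx (@complex.Re R) y) 0; last first.
  by rewrite ltr_wpDr ?ge0 ?M0.
rewrite ltr_wpDl ?ge0 ?M0 //; apply: contraNneq y0 => v0.
by rewrite (complexmx_Re_Im y) u0 v0 /complexmx !map_mx0 scaler0 addr0.
Qed.

Definition normsq k (y : 'cV[R[i]]_k) : R[i] := (adjmx y *m y) 0 0.

Lemma normsqE k (y : 'cV[R[i]]_k) : normsq y = \sum_i `|y i 0| ^+ 2.
Proof.
by rewrite /normsq mxE; apply: eq_bigr => i _; rewrite !mxE mulrC sqr_normc.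
Qed.

Lemma normsq_ge0 k (y : 'cV[R[i]]_k) : 0 <= normsq y.
Proof. by rewrite normsqE sumr_ge0 // => i _; rewrite exprn_ge0. Qed.

Lemma normsq_eq0 k (y : 'cV[R[i]]_k) : (normsq y == 0) = (y == 0).
Proof.
apply/eqP/eqP => [|->]; last by rewrite /normsq mulmx0 mxE.
rewrite normsqE => /eqP; rewrite psumr_eq0 => [/allP y0|i _]; last first.
  by rewrite exprn_ge0.
apply/colP => i; rewrite mxE; apply/eqP.
by have := y0 i (mem_index_enum i); rewrite sqrf_eq0 normr_eq0.
Qed.

Lemma pdmx_unit k (M : 'M[R]_k) : pdmx M -> M \in unitmx.
Proof.
case=> Msym M0; rewrite -row_free_unit -kermx_eq0; apply/rowV0P => v.
move/sub_kermxP => vM; apply/eqP; apply: contraT => v0.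
have := M0 v^T; rewrite trmxK vM mul0mx mxE ltxx trmx_eq0 => /(_ v0).
by [].
Qed.

(** Eigenvalues are defined through row vectors; the modes of a linear system are
    column vectors. *)
Lemma singular_eigenvector k (M : 'M[R[i]]_k) s : s%:M - M \notin unitmx ->
  exists2 x : 'cV_k, M *m x = s *: x & x != 0.
Proof.
rewrite -unitmx_tr -row_free_unit -kermx_eq0 => /rowV0Pn[v /sub_kermxP vM v0].
exists v^T; last by rewrite trmx_eq0.
have : (s%:M - M) *m v^T = 0.
  by apply: trmx_inj; rewrite trmx_mul trmxK vM trmx0.
by rewrite mulmxBl mul_scalar_mx => /subr0_eq.
Qed.

Lemma eigenvalue_singular k (M : 'M[R[i]]_k) s :
  eigenvalue M s = (s%:M - M \notin unitmx).
Proof.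
rewrite -row_free_unit -kermx_eq0; apply/eigenvalueP/rowV0Pn.
  move=> [v vM v0]; exists v => //; apply/sub_kermxP.
  by rewrite mulmxBr vM mul_mx_scalar subrr.
move=> [v /sub_kermxP vM v0]; exists v => //; apply/eqP.
by rewrite eq_sym -subr_eq0 -mul_mx_scalar -mulmxBr vM.
Qed.

End HermitianForms.

(** * The bounded real lemma *)

Section Dissipation.
Variable R : realType.
Local Open Scope complex_scope.

(** The Riccati expression of the bounded real lemma, congruent through P to the
    usual X A + A^T X + C^T C + mu X B B^T X with X = P^-1. *)
Definition riccati n l q (A P : 'M[R]_n) (B : 'M[R]_(n, l)) (C : 'M[R]_(q, n))
    (mu : R) : 'M[R]_n :=
  A *m P + P *m A^T + P *m C^T *m C *m P + mu *: (B *m B^T).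

(** Substitute A P y = s P y - B w in the form, then complete the square in w:
    mu |B^T y - w / mu|^2 = mu |B^T y|^2 - 2 Re(y^* B w) + |w|^2 / mu. *)
Lemma dissipation_identity n l q (A P : 'M[R]_n) (B : 'M[R]_(n, l))
    (C : 'M[R]_(q, n)) (mu : R) (s : R[i]) (y : 'cV[R[i]]_n) (w : 'cV[R[i]]_l) :
  P^T = P -> mu != 0 ->
  complexmx A *m (complexmx P *m y) + complexmx B *m w
    = s *: (complexmx P *m y) ->
  (adjmx y *m complexmx (riccati A P B C mu) *m y) 0 0
  = (s + conjc s) * (adjmx y *m complexmx P *m y) 0 0
    + normsq (complexmx C *m (complexmx P *m y))
    + mu%:C * normsq (complexmx B^T *m y - mu^-1%:C *: w)
    - mu^-1%:C * normsq w.
Proof.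
move=> Psym mu0; set x := complexmx P *m y => dyn.
have Ax : complexmx A *m x = s *: x - complexmx B *m w.
  by rewrite -dyn addrK.
have adjx : adjmx x = adjmx y *m complexmx P.
  by rewrite adjmxM adjmx_complexmx Psym.
have xA : adjmx x *m complexmx A^T
    = conjc s *: adjmx x - adjmx w *m complexmx B^T.
  by rewrite -!adjmx_complexmx -!adjmxM Ax adjmxB adjmxZ.
have muV : mu%:C * (mu^-1)%:C = 1 by rewrite -rmorphM mulfV ?rmorph1.
have -> : adjmx y *m complexmx (riccati A P B C mu) *m y
    = adjmx y *m (complexmx A *m x) + adjmx x *m complexmx A^T *m y
      + adjmx (complexmx C *m x) *m (complexmx C *m x)
      + mu%:C *: (adjmx (complexmx B^T *m y) *m (complexmx B^T *m y)).
  rewrite !adjmxM !adjmx_complexmx trmxK Psym /x /riccati /complexmx.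
  rewrite !map_mxD map_mxZ !map_mxM !mulmxDr !mulmxDl !mulmxA.
  by rewrite -scalemxAr -scalemxAl !mulmxA.
rewrite Ax xA /normsq mulmxBr mulmxBl -!scalemxAr -!scalemxAl.
rewrite [adjmx (_ - _)]adjmxB [adjmx (_ *: w)]adjmxZ conjc_real.
rewrite !mulmxBr !mulmxBl -!scalemxAr -!scalemxAl.
rewrite [adjmx (complexmx B^T *m y)]adjmxM adjmx_complexmx trmxK.
have -> : adjmx x *m y = adjmx y *m complexmx P *m y by rewrite adjx.
rewrite {1}/x !mulmxA !entryE.
ring: muV.
Qed.

Lemma addr_conjc (s : R[i]) : s + conjc s = 2 * 'Re s.
Proof. by rewrite ReE mulrC divfK ?pnatr_eq0. Qed.

Section BoundedReal.
Variables (n l q : nat) (A P : 'M[R]_n) (B : 'M[R]_(n, l)) (C : 'M[R]_(q, n)).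
Variable mu : R.
Hypotheses (Ppd : pdmx P) (mu0 : 0 < mu) (ric : nsdmx (riccati A P B C mu)).

(** The factor e is x^* P^-1 x, the energy stored in the state x. *)
Lemma dissipation (s : R[i]) (x : 'cV[R[i]]_n) (w : 'cV[R[i]]_l) :
  complexmx A *m x + complexmx B *m w = s *: x ->
  exists2 e, (x != 0 -> 0 < e) &
    (s + conjc s) * e + normsq (complexmx C *m x) <= mu^-1%:C * normsq w.
Proof.
move=> dyn; pose y := complexmx (invmx P) *m x.
have Pu := pdmx_unit Ppd.
have xE : complexmx P *m y = x.
  by rewrite mulmxA -map_mxM mulmxV // /complexmx map_mx1 mul1mx.
exists ((adjmx y *m complexmx P *m y) 0 0).
  move=> x0; apply: pdmx_hermitian_gt0 => //; apply: contraNneq x0 => y0.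
  by rewrite -xE y0 mulmx0.
have := psdmx_hermitian_ge0 y ric.
rewrite /complexmx map_mxN mulmxN mulNmx entryE oppr_ge0.
rewrite -xE in dyn.
rewrite (dissipation_identity C Ppd.1 (lt0r_neq0 mu0) dyn) xE.
rewrite subr_le0; apply: le_trans; rewrite lerDl.
by rewrite mulr_ge0 ?normsq_ge0 // ler0c ltW.
Qed.

(** The hypothesis is the eigenvector (Popov-Belevitch-Hautus) form of
    observability.  It excludes the purely imaginary eigenvalues, which a merely
    semi-definite Riccati inequality would allow. *)
Lemma riccati_stable :
  (forall s (x : 'cV[R[i]]_n), complexmx A *m x = s *: x ->
     complexmx C *m x = 0 -> x = 0) ->
  asymp_stable A.
Proof.
move=> pbh s; rewrite eigenvalue_singular => /singular_eigenvector[x Ax x0].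
have dyn : complexmx A *m x + complexmx B *m 0 = s *: x by rewrite mulmx0 addr0.
have [e /(_ x0) e0] := dissipation dyn.
rewrite {2}/normsq mulmx0 entryE mulr0.
have Cx0 : 0 < normsq (complexmx C *m x).
  rewrite lt_def normsq_ge0 normsq_eq0 andbT.
  by apply: contra_neq x0 => /(pbh _ _ Ax).
move=> diss; have : (s + conjc s) * e < 0.
  by apply: lt_le_trans diss; rewrite ltrDl.
by rewrite pmulr_llt0 // addr_conjc pmulr_rlt0.
Qed.

(** On the imaginary axis s + s^* = 0, so the stored energy drops out of the
    dissipation inequality and the gain from w to C x remains.  Stability ensures
    that the resolvent exists at s. *)
Lemma riccati_sigma_max (omega : R) : asymp_stable A ->
  sigma_max (complexmx C *m invmx ((0 +i* omega)%:M - complexmx A)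
               *m complexmx B) <= (Num.sqrt mu)^-1.
Proof.
move=> stabA; set s : R[i] := 0 +i* omega; set G := (_ *m complexmx B).
have s_conj : s + conjc s = 0 by rewrite addcJ mulr0.
have sA : s%:M - complexmx A \in unitmx.
  apply: contraT; rewrite -eigenvalue_singular => /stabA.
  by rewrite -(pmulr_rlt0 _ (ltr0Sn _ 1)) -addr_conjc s_conj ltxx.
have Gbound (w : 'cV_l) : normsq (G *m w) <= mu^-1%:C * normsq w.
  pose x := invmx (s%:M - complexmx A) *m (complexmx B *m w).
  have dyn : complexmx A *m x + complexmx B *m w = s *: x.
    apply/eqP; rewrite eq_sym addrC -subr_eq -mul_scalar_mx -mulmxBl.
    by rewrite mulKVmx.
  have [e _] := dissipation dyn.
  by rewrite s_conj mul0r add0r /G -!mulmxA.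
rewrite /sigma_max; clearbody G; set S := (X in sup X).
have Sle r : S r -> r <= (Num.sqrt mu)^-1.
  case=> lambda /= /eigenvalueP[v vG v0] <-.
  have {}vG : v *m (adjmx G *m G) = lambda%:C *: v by [].
  rewrite -(sqrtrV (ltW mu0)) ler_sqrt ?invr_ge0 ?(ltW mu0) //.
  pose w := adjmx v.
  have w0 : 0 < normsq w.
    rewrite lt_def normsq_ge0 normsq_eq0 andbT; apply: contra_neq v0 => w0.
    by rewrite -[v]adjmxK -/w w0 /adjmx trmx0 map_mx0.
  have := Gbound w; rewrite [normsq (G *m w)]/normsq adjmxM !mulmxA.
  rewrite /w adjmxK -[v *m _ *m G]mulmxA vG -scalemxAl entryE.
  rewrite -{1}[v]adjmxK -/w -/(normsq w) ler_pM2r //.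
  by rewrite lecR.
(* S is empty when w has dimension 0. *)
have [->|/set0P S0] := eqVneq S set0; last exact: ge_sup.
by rewrite sup0 invr_ge0 sqrtr_ge0.
Qed.

End BoundedReal.

(** * Observability of the closed loop *)

(** C A^k x = s^k C x, so an eigenvector in the kernel of C is in the kernel of
    the observability matrix, whose rank does not change from real to complex
    scalars. *)
Lemma observable_eigenvector n q (A : 'M[R]_n) (C : 'M[R]_(q, n)) s
    (x : 'cV[R[i]]_n) :
  observable A C -> complexmx A *m x = s *: x -> complexmx C *m x = 0 -> x = 0.
Proof.
rewrite /observable; set O := \mxcol_k _ => rkO Ax Cx.
have full : row_full (complexmx O) by rewrite /row_full mxrank_map rkO.
rewrite -[x]mul1mx -(mulVpmx full) -mulmxA.
suff -> : complexmx O *m x = 0 by rewrite mulmx0.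
have -> : complexmx O = \mxcol_(k < n) complexmx (C *m A ^+ k).
  by apply/matrixP => i j; rewrite !mxE.
have Akx k : complexmx (A ^+ k) *m x = s ^+ k *: x.
  elim: k => [|k IHk]; first by rewrite /complexmx map_mx1 mul1mx scale1r.
  rewrite exprSr /complexmx map_mxM -mulmxA Ax -scalemxAr IHk scalerA.
  by rewrite exprS.
have CAx k : complexmx (C *m A ^+ k) *m x = 0.
  by rewrite /complexmx map_mxM -mulmxA Akx -scalemxAr Cx scaler0.
by rewrite mxcol_mul; apply/matrixP => i j; rewrite mxE CAx !mxE.
Qed.

(** When the columns of C are orthogonal to those of D, a vector in the kernel of
    C - D K lies in the kernels of C and of K: multiply by C^T and by D^T.  On
    such a vector feedback does nothing, so an unobservable closed-loop mode
    would be an unobservable open-loop mode. *)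
Lemma closed_loop_observable n m q (A : 'M[R]_n) (B2 : 'M[R]_(n, m))
    (C : 'M[R]_(q, n)) (D : 'M[R]_(q, m)) (K : 'M[R]_(m, n)) s
    (x : 'cV[R[i]]_n) :
  C^T *m D = 0 -> pdmx (D^T *m D) -> observable A C ->
  complexmx (A - B2 *m K) *m x = s *: x -> complexmx (C - D *m K) *m x = 0 ->
  x = 0.
Proof.
move=> CD0 DDpd obs Ax zx.
have DC0 := trmx_mul_eq0 CD0.
have Kx : complexmx K *m x = 0.
  have : complexmx (D^T *m (C - D *m K)) *m x = 0.
    by rewrite /complexmx map_mxM -mulmxA zx mulmx0.
  rewrite mulmxBr DC0 sub0r mulmxA /complexmx map_mxN mulNmx map_mxM -mulmxA.
  move/eqP; rewrite oppr_eq0 => /eqP DDKx.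
  have DDu : map_mx (real_complex R) (D^T *m D) \in unitmx.
    by rewrite map_unitmx pdmx_unit.
  by rewrite -[LHS](mulKmx DDu) DDKx mulmx0.
apply: (observable_eigenvector obs (s := s)).
  by rewrite -Ax /complexmx map_mxB map_mxM mulmxBl -mulmxA Kx mulmx0 subr0.
by rewrite -zx /complexmx map_mxB map_mxM mulmxBl -mulmxA Kx mulmx0 subr0.
Qed.

(** * Feasible models *)

(** P is common to all terms, so the expression is affine in its first argument;
    the weights sum to 1, which preserves its constant part. *)
Lemma riccati_convex n l q N (xi : 'I_N -> R) (As : 'I_N -> 'M[R]_n)
    (P : 'M[R]_n) (B : 'M[R]_(n, l)) (C : 'M[R]_(q, n)) (mu : R) :
  \sum_i xi i = 1 ->
  riccati (\sum_i xi i *: As i) P B C mu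
    = \sum_i xi i *: riccati (As i) P B C mu.
Proof.
move=> xi1; rewrite /riccati.
under [RHS]eq_bigr do rewrite !scalerDr.
rewrite !big_split /= -!scaler_suml xi1 !scale1r; congr (_ + _ + _ + _).
  by rewrite mulmx_suml; apply: eq_bigr => i _; rewrite scalemxAl.
rewrite linear_sum mulmx_sumr; apply: eq_bigr => i _ /=.
by rewrite linearZ scalemxAr.
Qed.

Lemma nsdmx_convex n N (xi : 'I_N -> R) (Ms : 'I_N -> 'M[R]_n) :
  (forall i, 0 <= xi i) -> (forall i, nsdmx (Ms i)) ->
  nsdmx (\sum_i xi i *: Ms i).
Proof.
move=> xi0 Ms0; rewrite /nsdmx -sumrN; split=> [|x].
  rewrite linear_sum; apply: eq_bigr => i _ /=.
  by rewrite -scalerN linearZ /= (Ms0 i).1.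
rewrite mulmx_sumr mulmx_suml summxE sumr_ge0 // => i _.
by rewrite -scalerN -scalemxAr -scalemxAl entryE mulr_ge0 // (Ms0 i).2.
Qed.

Section Uncertain.
Variables (n m l q N : nat).
Variables (As : 'I_N -> 'M[R]_n) (B2s : 'I_N -> 'M[R]_(n, m)).
Variables (B1 : 'M[R]_(n, l)) (C : 'M[R]_(q, n)) (D : 'M[R]_(q, m)).

Lemma feasible_closed_loop A B2 (K : 'M[R]_(m, n)) :
  feasible_model As B2s A B2 -> exists xi : 'I_N -> R,
    [/\ forall i, 0 <= xi i, \sum_i xi i = 1
      & A - B2 *m K = \sum_i xi i *: (As i - B2s i *m K)].
Proof.
case=> xi [xi0 xi1 F]; exists xi; split=> //.
(* A - B2 K is the nonzero block of F times the column (1, K), so it depends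
   linearly on F. *)
have FK : A - B2 *m K
    = usubmx (extmx A B2 *m col_mx 1%:M K).
  by rewrite /extmx mul_block_col mulmx1 mulNmx col_mxKu.
rewrite FK F mulmx_suml linear_sum; apply: eq_bigr => i _ /=.
rewrite -scalemxAl linearZ /= /extmx mul_block_col mulmx1 mulNmx.
by rewrite col_mxKu.
Qed.

Lemma feasible_extreme i : feasible_model As B2s (As i) (B2s i).
Proof.
exists (fun j => (j == i)%:R); split=> [j||]; first exact: ler0n.
  by rewrite (bigD1 i) //= eqxx big1 ?addr0 // => j /negPf->.
rewrite (bigD1 i) //= eqxx scale1r big1 ?addr0 // => j /negPf->.
by rewrite scale0r.
Qed.

Hypothesis CD0 : C^T *m D = 0.

(** The gain is chosen so that W2 = P K^T, and C^T D = 0 makes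
    C^T C + K^T D^T D K the Gram matrix of C - D K. *)
Lemma Theta1_riccati i (W : 'M[R]_(n + m)) mu :
  pdmx (ulsubmx W) -> W^T = W ->
  Theta1 As B2s B1 C D i W mu
    = riccati (As i - B2s i *m gain W) (ulsubmx W) B1 (C - D *m gain W) mu.
Proof.
move=> W1pd Wsym; have W1u := pdmx_unit W1pd.
set K := gain W; set P := ulsubmx W in W1pd W1u *.
have Psym : P^T = P := W1pd.1.
have KP : K *m P = (ursubmx W)^T by rewrite /K /gain mulmxKV.
have PK : P *m K^T = ursubmx W.
  by rewrite -[LHS]trmxK trmx_mul trmxK Psym KP trmxK.
have dlE : dlsubmx W = K *m P by rewrite KP trmx_ursub Wsym.
have WE : W = block_mx P (P *m K^T) (K *m P) (drsubmx W).
  by rewrite PK -dlE submxK.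
clearbody K P.
have DC0 := trmx_mul_eq0 CD0.
have zz : (C - D *m K)^T *m (C - D *m K) = C^T *m C + K^T *m (D^T *m D) *m K.
  rewrite [(C - D *m K)^T]linearB /= trmx_mul mulmxBl !mulmxBr.
  rewrite !mulmxA CD0 mul0mx subr0.
  by rewrite -[K^T *m _ *m C]mulmxA DC0 mulmx0 sub0r opprK.
rewrite /Theta1 /Theta WE /extmx /Rmx /Qmx tr_block_mx !mulmx_block.
rewrite scale_block_mx !add_block_mx block_mxKul !mulmx0 !addr0 !add0r.
rewrite /riccati -[_ *m (C - D *m K)]mulmxA zz mulmxBl mulmxDr mulmxDl.
rewrite [(- _)^T]linearN [(As i - _)^T]linearB /= trmx_mul.
by rewrite mulmxBr mulmxN mulNmx !mulmxA.
Qed.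

Lemma CU_riccati W mu A B2 : CU As B2s B1 C D (W, mu) ->
  feasible_model As B2s A B2 ->
  nsdmx (riccati (A - B2 *m gain W) (ulsubmx W) B1 (C - D *m gain W) mu).
Proof.
case=> /= W1pd [Wsym _] Th _ /(feasible_closed_loop (gain W))[xi [xi0 xi1 ->]].
rewrite riccati_convex //; apply: nsdmx_convex => // i.
by rewrite -Theta1_riccati.
Qed.

Hypothesis DDpd : pdmx (D^T *m D).
Hypothesis obs : forall A B2, feasible_model As B2s A B2 -> observable A C.

Lemma CU_robustly_stabilizing W mu :
  CU As B2s B1 C D (W, mu) -> robustly_stabilizing As B2s (gain W).
Proof.
move=> WCU A B2 feas; have [/= W1pd _ _ mu0] := WCU.
apply: (riccati_stable W1pd mu0 (CU_riccati WCU feas)) => s x.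
exact: closed_loop_observable (obs feas).
Qed.

Lemma CU_robust_hinf_bound W mu :
  CU As B2s B1 C D (W, mu) ->
  robust_hinf_bound As B2s B1 C D (gain W) (cost_bound mu).
Proof.
move=> WCU A B2 feas; have [/= W1pd _ _ mu0] := WCU.
apply: ge_ereal_sup => _ [omega _ <-]; rewrite lee_fin.
apply: (riccati_sigma_max W1pd mu0 (CU_riccati WCU feas)).
exact: CU_robustly_stabilizing WCU _ _ feas.
Qed.

End Uncertain.
End Dissipation.

Theorem theorem2 (R : realType) (n m l q N : nat)
  (As : 'I_N -> 'M[R]_n) (B2s : 'I_N -> 'M[R]_(n, m))
  (B1 : 'M[R]_(n, l)) (C : 'M[R]_(q, n)) (D : 'M[R]_(q, m))
  (stab : forall A B2, feasible_model As B2s A B2 ->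
     exists2 gamma : R, 0 < gamma & stabilizable_attenuation A B2 B1 C D gamma)
  (obs : forall A B2, feasible_model As B2s A B2 -> observable A C)
  (CD0 : C^T *m D = 0)
  (DDpd : pdmx (D^T *m D)) :
  (forall (W : 'M[R]_(n + m)) (mu : R), CU As B2s B1 C D (W, mu) ->
     [/\ robustly_stabilizing As B2s (gain W),
         0 < cost_bound mu
       & forall i : 'I_N,
           (hinf_norm (As i) (B2s i) B1 C D (gain W)
              <= (cost_bound mu)%:E)%E])
  /\
  (forall (Ws : 'M[R]_(n + m)) (mus : R), CU_argmax As B2s B1 C D Ws mus ->
     guaranteed_cost_optimal As B2s B1 C D (gain Ws) (cost_bound mus)
     /\ forall (W : 'M[R]_(n + m)) (mu : R), CU As B2s B1 C D (W, mu) ->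
          cost_bound mus <= cost_bound mu).
Proof.
have cost_anti (mu nu : R) :
    0 < mu -> mu <= nu -> cost_bound nu <= cost_bound mu.
  move=> mu0 le_mu_nu; have nu0 := lt_le_trans mu0 le_mu_nu.
  by rewrite lef_pV2 ?posrE ?sqrtr_gt0 // ler_sqrt // ltW.
split=> [W mu WCU|W mu [WCU max]].
  split; first exact: CU_robustly_stabilizing WCU.
    by case: WCU => _ _ _ mu0; rewrite invr_gt0 sqrtr_gt0.
  move=> i; apply: (CU_robust_hinf_bound CD0 DDpd obs WCU).
  exact: feasible_extreme.
have opt W' mu' :
    CU As B2s B1 C D (W', mu') -> cost_bound mu <= cost_bound mu'.
  by move=> WCU'; apply: cost_anti (max _ _ WCU'); case: WCU'.
split=> //; split.
  split; [exact: CU_robustly_stabilizing WCU| |by exists W, mu].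
  exact: CU_robust_hinf_bound WCU.
by move=> K gamma [_ _ [W' [mu' [WCU' _ ->]]]]; apply: opt WCU'.
Qed.
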